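(* Let $\lambda$ be an infinite regular cardinal and assume the stick principle ${\mid\!\bullet}(\lambda^+)$ holds. Then for every partition $\mathcal S$ of $E^{\lambda^+}_{\lambda}=\{\alpha<\lambda^+\mid\mathrm{cf}(\alpha)=\lambda\}$ into stationary sets, $\clubsuit_{\mathrm{ad}}(\mathcal S,\lambda,\lambda)$ holds.
   Context: ${\mid\!\bullet}(\lambda^+)$ asserts that there is a sequence $\langle x_\beta\mid\beta<\lambda^+\rangle$ of elements of $[\lambda^+]^\lambda$ such that for every cofinal $X\subseteq\lambda^+$ there is $\beta<\lambda^+$ with $x_\beta\subseteq X$. For a regular uncountable $\kappa$, a collection $\mathcal S$ of stationary subsets of $\kappa$ and nonzero cardinals $\mu,\theta<\kappa$, $\clubsuit_{\mathrm{ad}}(\mathcal S,\mu,\theta)$ asserts the existence of $\langle\mathcal A_\alpha\mid\alpha\in\bigcup\mathcal S\rangle$ such that: (i) for every limit ordinal $\alpha\in\bigcup\mathcal S$, $\mathcal A_\alpha$ is a pairwise disjoint family of $\mu$ many cofinal subsets of $\alpha$; (ii) for every $\mathcal B\subseteq[\kappa]^\kappa$ of size $\theta$ and every $S\in\mathcal S$, there are stationarily many $\alpha\in S$ with $\sup(A\cap B)=\alpha$ for all $A\in\mathcal A_\alpha$, $B\in\mathcal B$; (iii) for all distinct $A,A'$ from $\bigcup_{S\in\mathcal S}\bigcup_{\alpha\in S}\mathcal A_\alpha$, $\sup(A\cap A')<\sup(A)$. *)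

(* Defs.v *)
From mathcomp Require Import all_boot all_order.
From mathcomp Require Import boolp classical_sets functions cardinality wochoice.

Set Implicit Arguments.
Unset Strict Implicit.
Unset Printing Implicit Defensive.

Import Order.TTheory.
Local Open Scope classical_set_scope.
Local Open Scope card_scope.
Local Open Scope order_scope.

(* The elements of a well-ordered type T play the role of ordinals: a : T
   stands for the order type of its initial segment. The definitions make sense
   for any total order, and the well-ordering of T is a hypothesis of the
   theorem. Every ordinal k is obtained as an element of some such T (for
   instance T = k + 1), and the notions below do not depend on the choice
   of T. *)
Section Ordinals.
Context {d : Order.disp_t} {T : orderType d}.
Implicit Types (a b k lam mu theta : T) (A B C X : set T).

Definition seg a : set T := [set x | x < a].

Definition cofinal_in A a :=
  A `<=` seg a /\ forall b, b < a -> exists2 x, A x & b <= x.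

Definition is_limit a :=
  (exists b, b < a) /\ forall b, b < a -> exists2 c, b < c & c < a.

Definition is_cardinal a := forall b, b < a -> ~ (seg a #<= seg b).

Definition cf_is a mu :=
  [/\ is_cardinal mu,
      exists2 A, cofinal_in A a & A #= seg mu
    & forall A, cofinal_in A a -> seg mu #<= A].

Definition infinite_regular_cardinal a :=
  [/\ is_cardinal a, infinite_set (seg a) & cf_is a a].

Definition succ_cardinal lam k :=
  [/\ is_cardinal k, lam < k
    & forall nu, is_cardinal nu -> lam < nu -> k <= nu].

Definition E_cof k lam : set T := [set a | a < k /\ cf_is a lam].

Definition is_club k C :=
  cofinal_in C k /\
  forall a, a < k -> is_limit a -> cofinal_in (C `&` seg a) a -> C a.

Definition stationary k A :=
  A `<=` seg k /\ forall C, is_club k C -> A `&` C !=set0.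

Definition subsets_of_size k mu : set (set T) :=
  [set X | X `<=` seg k /\ X #= seg mu].

(* [stick lam k] is the stick principle at k, where k is meant to be lam^+. *)
Definition stick lam k :=
  exists x : T -> set T,
    (forall b, b < k -> subsets_of_size k lam (x b)) /\
    forall X, cofinal_in X k -> exists2 b, b < k & x b `<=` X.

(* [supremums A] is the set of least upper bounds of A; it is a singleton for
   bounded A in a well-order, and sup set0 is the least ordinal 0. *)
Definition sup_is A a := supremums A a.

Definition sup_lt A B := exists s t, [/\ sup_is A s, sup_is B t & s < t].

(* To be used for k a regular uncountable cardinal, SS a collection of
   stationary subsets of k and mu, theta nonzero cardinals below k. The
   sequence is given by a total function on T, of which only the values on
   the union of SS matter. *)
Definition club_ad k (SS : set (set T)) mu theta :=
  exists AA : T -> set (set T),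
  [/\ forall a, (\bigcup_(S in SS) S) a -> is_limit a ->
        [/\ trivIset (AA a) id, AA a #= seg mu
          & forall A, AA a A -> cofinal_in A a],
      forall BB : set (set T), BB `<=` subsets_of_size k k ->
        BB #= seg theta -> forall S, SS S ->
        stationary k [set a | S a /\
          forall A B, AA a A -> BB B -> sup_is (A `&` B) a]
    & forall A A', (\bigcup_(S in SS) \bigcup_(a in S) AA a) A ->
        (\bigcup_(S in SS) \bigcup_(a in S) AA a) A' ->
        A <> A' -> sup_lt (A `&` A') A].

End Ordinals.

(* Main.v *)
From Stdlib Require Import Inverse_Image.
Require Import Defs.
From mathcomp Require Import all_boot all_order.
From mathcomp Require Import boolp classical_sets functions cardinality wochoice.

Set Implicit Arguments.
Unset Strict Implicit.
Unset Printing Implicit Defensive.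

(** The stick sequence x may be assumed to consist of sets of order type lam.
    By recursion on a in E_lam one builds a set A_a, split into lam disjoint
    pieces, that meets all earlier A_t, and all x_b with b, sup x_b < a, in fewer
    than lam points; this gives (iii), as cf(t) = lam. A single guess x_b may be
    covered by few of the A_t, so one uses guesses of rank two: the union of the
    x_b for b in x_e, where the x_b are placed one above the other, beyond the
    preceding indices. Each A_t and each x_w meets at most one of these x_b in
    lam many points, so that fewer than lam of the A_t and x_w never cover the
    union, and A_a can be made to meet all unions with e < a. Every cofinal B
    contains such unions arbitrarily high (apply the stick principle first inside
    B, then to a set of indices), whence sup (A_a `&` B) = a for all a in E_lam in
    a club, which can be taken common to lam many sets B. *)

(** * Comparison of cardinals and well-founded recursion *)

Section Generalities.
Local Open Scope classical_set_scope.
Local Open Scope card_scope.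

Lemma card_le_injP (U V : Type) (A : set U) (B : set V) (v0 : V) :
  A #<= B <-> exists f : U -> V,
    (forall x, A x -> B (f x)) /\ (forall x y, A x -> A y -> f x = f y -> x = y).
Proof.
split=> [/card_leP[f]|[f [fAB finj]]].
  exists (fun x => if pselect (A x) is left Ax then val (f (SigSub (mem_set Ax)))
                   else v0); split=> [x Ax|x y Ax Ay].
    by case: pselect => // ?; exact: set_valP.
  case: pselect => // Ax'; case: pselect => // Ay' /val_inj.
  by move=> /(@inj _ _ _ f) - /(_ (mem_set I) (mem_set I)) /(congr1 val).
apply: (@card_le_trans _ _ _ (f @` A)); last first.
  by apply: subset_card_le => _ [x Ax <-]; exact: fAB.
have : f @` A #= A.
  by apply: inj_card_eq => x y /set_mem Ax /set_mem Ay; exact: finj.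
by rewrite card_eq_le => /andP[].
Qed.

(** The existence of a value is asked at each [p] separately and for the final [f], because it can
    often be derived only from the properties of the values chosen before [p]. *)
Lemma wf_dependent_choice (P V : Type) (R : P -> P -> Prop) (v0 : V)
    (Q : P -> (P -> V) -> V -> Prop) :
  well_founded R ->
  (forall p g g' v, (forall q, R q p -> g q = g' q) -> Q p g v -> Q p g' v) ->
  exists f : P -> V, forall p, (exists v, Q p f v) -> Q p f (f p).
Proof.
move=> wfR Qext.
(* [Q] takes total functions, so a function on the predecessors of [p] is extended by the default
   [v0]. *)
pose ext p (r : forall q, R q p -> V) q :=
  if pselect (R q p) is left Rqp then r q Rqp else v0.
pose F p (r : forall q, R q p -> V) : V :=
  if pselect (exists v, Q p (ext p r) v) is left e then sval (cid e) else v0.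
pose f := Fix wfR (fun=> V) F.
have fE p : f p = F p (fun q _ => f q).
  apply: Fix_eq => q r r' rr'; congr F.
  by apply: functional_extensionality_dep => s; apply: functional_extensionality_dep.
exists f => p [v Qv]; rewrite fE /F.
have ef q : R q p -> ext p (fun q _ => f q) q = f q.
  by rewrite /ext; case: pselect.
case: pselect => [e|[]].
  by apply: (Qext p _ _ _ ef); exact: svalP.
by exists v; apply: Qext Qv => q /ef.
Qed.

(* Greedy injection along a well-order: some point of B is always unused. *)
Lemma card_le_wf (P V : Type) (R : P -> P -> Prop) (A : set P) (B : set V) :
  well_founded R ->
  (forall p q, A p -> A q -> p <> q -> R p q \/ R q p) ->
  (forall p, A p -> ~ (B #<= [set q | A q /\ R q p])) ->
  A #<= B.
Proof.
move=> wfR Rtot AB.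
have [->|/set0P[a Aa]] := eqVneq A set0; first exact: card_ge0.
have [v0 _] : B !=set0.
  by apply/set0P/eqP => B0; apply: (AB a Aa); rewrite B0 card_ge0.
have [f fP] := @wf_dependent_choice P V R v0
  (fun p g v => B v /\ forall q, A q -> R q p -> g q <> v) wfR
  (fun p g g' v gg' => fun '(conj Bv gv) =>
    conj Bv (fun q Aq Rqp => eq_rect _ (fun w => w <> v) (gv q Aq Rqp) _ (gg' q Rqp))).
have fA p : A p -> B (f p) /\ forall q, A q -> R q p -> f q <> f p.
  move=> Ap; apply: fP; apply: contrapT => /forallNP H; apply: (AB p Ap).
  have BI : B `<=` f @` [set q | A q /\ R q p].
    move=> v Bv; apply: contrapT => fv; apply: (H v); split=> // q Aq Rqp fq.
    by apply: fv; exists q.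
  exact: card_le_trans (subset_card_le BI) (card_image_le _ _).
apply/(card_le_injP _ _ v0); exists f; split=> [p /fA[]//|p q Ap Aq fpq].
apply: contrapT => pq; have [Rpq|Rqp] := Rtot p q Ap Aq pq.
  by case: (fA q Aq) => _ /(_ p Ap Rpq).
by case: (fA p Ap) => _ /(_ q Aq Rqp); rewrite fpq.
Qed.

Lemma card_le_setX (U V U' V' : Type) (A : set U) (B : set V)
    (A' : set U') (B' : set V') :
  A #<= A' -> B #<= B' -> A `*` B #<= A' `*` B'.
Proof.
move=> AA BB; have [->|/set0P[a Aa]] := eqVneq A set0.
  by rewrite set0X card_ge0.
have [->|/set0P[b Bb]] := eqVneq B set0; first by rewrite setX0 card_ge0.
have [u0 _] : A' !=set0.
  by apply/set0P/eqP => E; move: AA; rewrite E => /card_le0P A0; move: Aa; rewrite A0.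
have [v0 _] : B' !=set0.
  by apply/set0P/eqP => E; move: BB; rewrite E => /card_le0P B0; move: Bb; rewrite B0.
have /(card_le_injP _ _ u0)[f [fA fi]] := AA.
have /(card_le_injP _ _ v0)[g [gB gi]] := BB.
apply/(card_le_injP _ _ (u0, v0)).
exists (fun p => (f p.1, g p.2)); split=> [[x y] [/= Ax By]|].
  by split; [exact: fA|exact: gB].
move=> [x y] [x' y'] [/= Ax By] [/= Ax' By'] [] fx gy.
by rewrite (fi _ _ Ax Ax' fx) (gi _ _ By By' gy).
Qed.

End Generalities.

(** * Hessenberg's theorem: squares of infinite initial segments *)

Section WellOrder.
Local Open Scope order_scope.
Local Open Scope classical_set_scope.
Local Open Scope card_scope.
Import Order.TTheory.
Context {d : Order.disp_t} {T : orderType d}.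
Implicit Types (a b c k lam : T) (A B C X : set T).

Lemma wo_min (A : set T) : @well_order T (fun x y : T => x <= y) ->
  A !=set0 -> exists2 m, A m & forall x, A x -> m <= x.
Proof.
move=> wo [x Ax]; have [|m [[Am mA] _]] := wo (fun x => `[< A x >]).
  by exists x; apply/asboolP.
by exists m => [|y Ay]; [apply/asboolP|apply: mA; apply/asboolP].
Qed.

Lemma wo_wf : @well_order T (fun x y : T => x <= y) ->
  well_founded (fun x y : T => x < y).
Proof.
move=> wo a; apply: contrapT => na.
have [|m nm mP] := @wo_min [set x | ~ Acc (fun x y : T => x < y) x] wo.
  by exists a.
apply: nm; constructor => y ym; apply: contrapT => ny.
by have := mP y ny; rewrite leNgt ym.
Qed.

(** Goedel's well-order of pairs: by maximum, then lexicographically. *)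
Definition godel_lt (p q : T * T) :=
  Order.max p.1 p.2 < Order.max q.1 q.2 \/
  Order.max p.1 p.2 = Order.max q.1 q.2 /\
    (p.1 < q.1 \/ p.1 = q.1 /\ p.2 < q.2).

Lemma godel_lt_wf : @well_order T (fun x y : T => x <= y) ->
  well_founded godel_lt.
Proof.
move=> wo; have wf := wo_wf wo.
suff H m : forall x y p, Order.max p.1 p.2 = m -> p.1 = x -> p.2 = y ->
    Acc godel_lt p by move=> p; exact: (H _ _ _ p erefl erefl erefl).
elim: m / (wf m) => m _ IHm x; elim: x / (wf x) => x _ IHx y.
elim: y / (wf y) => y _ IHy p pm px py; constructor => q.
rewrite /godel_lt pm px py => -[qm|[qm [qx|[qx qy]]]].
- exact: IHm qm _ _ _ erefl erefl erefl.
- exact: IHx qx _ _ qm erefl erefl.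
- exact: IHy qy _ qm qx erefl.
Qed.

(** Induction on [b]. If [seg b] embeds in a smaller [seg c], the claim for [c] carries over.
    Otherwise every proper initial segment of the square under [godel_lt] lies in the square of some
    [seg c] with [c < b], which is too small to receive [seg b], so [card_le_wf] applies. *)
Lemma card_seg_square (wo : @well_order T (fun x y : T => x <= y)) b :
  infinite_set (seg b) -> seg b `*` seg b #<= seg b.
Proof.
elim: b / (wo_wf wo b) => b _ IHb infb.
have [[c cb bc]|/forall2NP bcard] := pselect (exists2 c, c < b & seg b #<= seg c).
  have infc : infinite_set (seg c).
    by move=> fc; apply: infb; exact: card_le_finite bc fc.
  apply: card_le_trans (card_le_setX bc bc) _.
  apply: card_le_trans (IHb c cb infc) _.
  by apply: subset_card_le => x /= xc; exact: lt_trans cb.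
have nb c : c < b -> ~ (seg b #<= seg c) by move=> cb; case: (bcard c).
(* An infinite initial ordinal is a limit: if [b] were the successor of [c], then [seg b] would
   embed in the square of [seg c], hence in [seg c]. *)
have limb c : c < b -> exists2 c', c < c' & c' < b.
  move=> cb; apply: contrapT => /forall2NP H.
  have bE : seg b = seg c `|` [set c].
    apply/seteqP; split=> x /=; last by case=> [xc|->//]; exact: lt_trans cb.
    move=> xb; have [->|xc] := eqVneq x c; [by right|left].
    by case: (H x) => // /negP; rewrite -leNgt le_eqVlt (negPf xc).
  have infc : infinite_set (seg c).
    by move=> fc; apply: infb; rewrite bE finite_setU; split=> //; exact: finite_set1.
  have [[x1 x1c] [x2 x2c x12]] : seg c !=set0 /\
      exists2 x2, seg c x2 & x2 <> xget c (seg c).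
    split; first exact: infinite_setN0.
    have : infinite_set (seg c `\` [set xget c (seg c)]).
      by apply: infinite_setD => //; exact: finite_set1.
    by move=> /infinite_setN0[x [xc /= xn]]; exists x.
  set x0 := xget c (seg c) in x12.
  have x0c : seg c x0 by apply: xgetPex; exists x1.
  apply: (nb c cb); apply: card_le_trans (IHb c cb infc).
  apply/(card_le_injP _ _ (c, c)).
  exists (fun x => if x == c then (x0, x2) else (x, x0)); split=> [x|x y].
    rewrite bE => -[xc|->]; last by rewrite eqxx.
    by case: eqP => [xE|_]; split.
  by move=> _ _; case: eqP => [->|xc]; case: eqP => [->//|yc] [] // *;
    case: x12.
apply: (@card_le_wf _ _ godel_lt) => [|p q _ _ pq|[p q] [/= pb qb]].
- exact: godel_lt_wf.
- case: p q pq => p1 p2 [q1 q2] pq; rewrite /godel_lt /=.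
  case: (ltgtP (Order.max p1 p2) (Order.max q1 q2)) => [||mE]; [by left; left|by right; left|].
  case: (ltgtP p1 q1) => [||E1]; [by left; right; split; last left|by right; right; split; last left|].
  case: (ltgtP p2 q2) => [||E2].
  + by left; right; split=> //; right.
  + by right; right; split=> //; right.
  by case: pq; rewrite E1 E2.
have mb : Order.max p q < b by rewrite gt_max pb qb.
have [c mc cb] := limb _ mb.
have sub : [set r | (seg b `*` seg b) r /\ godel_lt r (p, q)] `<=` seg c `*` seg c.
  move=> [x y] [_ H]; have : Order.max x y <= Order.max p q.
    by case: H => /= [/ltW//|[-> //]].
  by move=> /le_lt_trans/(_ mc); rewrite gt_max => /andP[].
move=> /card_le_trans /(_ (subset_card_le sub)) H.
have [fc|infc] := pselect (finite_set (seg c)).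
  by apply: infb; apply: card_le_finite H _; exact: finite_setX.
exact: nb cb (card_le_trans H (IHb c cb infc)).
Qed.

End WellOrder.

(** * Fewer than [lam] points, and the regularity of [lam] *)

Section SuccessorOfRegular.
Local Open Scope order_scope.
Local Open Scope classical_set_scope.
Local Open Scope card_scope.
Import Order.TTheory.
Context {d : Order.disp_t} {T : orderType d}.
Context (T_wo : @well_order T (fun x y : T => x <= y)) (lam k : T).
Context (lam_reg : infinite_regular_cardinal lam) (k_succ : succ_cardinal lam k).
Implicit Types (a b c : T) (A B C X : set T).

(** As a negated inequality, smallness passes to subsets and images without comparability of
    cardinals. *)
Definition small {U : Type} (X : set U) := ~ (seg lam #<= X).

Lemma not_cofinal_bounded a X :
  X `<=` seg a -> ~ cofinal_in X a -> exists2 c, c < a & X `<=` seg c.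
Proof.
move=> Xa nX; apply: contrapT => /forall2NP H; apply: nX; split=> // b ba.
apply: contrapT => /forall2NP Hb; case: (H b) => // -[] x Xx /=.
by case: (Hb x) => // /negP; rewrite -ltNge.
Qed.

Lemma small_card_le (U V : Type) (X : set U) (Y : set V) :
  X #<= Y -> small Y -> small X.
Proof. by move=> XY sY lX; apply: sY; exact: card_le_trans XY. Qed.

Lemma small_subset (U : Type) (X Y : set U) : X `<=` Y -> small Y -> small X.
Proof. by move=> /subset_card_le; exact: small_card_le. Qed.

Lemma small_image (U V : Type) (f : U -> V) (X : set U) : small X -> small (f @` X).
Proof. exact/small_card_le/card_image_le. Qed.

Lemma small_finite (U : Type) (X : set U) : finite_set X -> small X.
Proof. by move=> fX lX; case: lam_reg => _ + _; apply; exact: card_le_finite fX. Qed.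

Lemma small_seg b : b < lam -> small (seg b).
Proof. by case: lam_reg => + _ _; apply. Qed.

Lemma small_bounded a X :
  cf_is a lam -> X `<=` seg a -> small X -> exists2 c, c < a & X `<=` seg c.
Proof.
by move=> [_ _ cfa] Xa sX; apply: not_cofinal_bounded => // /cfa.
Qed.

Lemma cf_lam : cf_is lam lam.
Proof. by case: lam_reg. Qed.

Lemma cf_gt a b : cf_is a lam -> b < a -> exists2 c, b < c & c < a.
Proof.
move=> cfa ba; have [||c ca bc] := @small_bounded a [set b] cfa.
- by move=> _ ->.
- exact/small_finite/finite_set1.
by exists c => //; exact: bc.
Qed.

Lemma cf_nonempty a : cf_is a lam -> exists b, b < a.
Proof.
move=> cfa; have [||c ca _] := @small_bounded a set0 cfa.
- exact: sub0set.
- exact/small_finite/finite_set0.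
by exists c.
Qed.

Lemma cf_limit a : cf_is a lam -> is_limit a.
Proof. by move=> cfa; split; [exact: cf_nonempty|move=> b; exact: cf_gt]. Qed.

Lemma small_seg_le b : b < lam -> small [set x | x <= b].
Proof.
move=> blam; have [c bc clam] := cf_gt cf_lam blam.
apply: small_subset (small_seg clam) => x /= xb; exact: le_lt_trans bc.
Qed.

(** Let [f] embed [seg lam] in the union. For each [i] the arguments sent into [F i] are bounded by
    some [c i] below [lam], and these bounds by one [c0], again by regularity. But [f c0] lies in
    some [F i], which forces [c0 < c i]. *)
Lemma small_bigcup (I U : Type) (D : set I) (F : I -> set U) :
  small D -> (forall i, D i -> small (F i)) -> small (\bigcup_(i in D) F i).
Proof.
move=> sD sF.
have [->|/set0P[u0 _]] := eqVneq (\bigcup_(i in D) F i) set0.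
  exact/small_finite/finite_set0.
move=> /(card_le_injP _ _ u0)[f [fF finj]].
have /choice[c cP] : forall i, exists c,
    D i -> c < lam /\ forall x, x < lam -> F i (f x) -> x < c.
  move=> i; have [Di|nDi] := pselect (D i); last by exists lam.
  have [||c clam cP] := @small_bounded lam [set x | x < lam /\ F i (f x)] cf_lam.
  - by move=> x [].
  - apply: small_card_le (sF i Di); apply/(card_le_injP _ _ u0); exists f.
    by split=> [x []//|x y [xl _] [yl _]]; exact: finj.
  by exists c => _; split=> // x xl Fx; exact: cP.
have [||c0 c0lam c0P] := @small_bounded lam (c @` D) cf_lam.
- by move=> _ [i Di <-]; exact: (cP i Di).1.
- exact: small_image.
have [i Di Fi] := fF c0 c0lam.
have := (cP i Di).2 c0 c0lam Fi; apply/negP; rewrite -leNgt.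
by apply: ltW; apply: c0P; exists i.
Qed.

Lemma setU_bigcup_bool (U : Type) (X Y : set U) :
  X `|` Y = \bigcup_(t in [set: bool]) (if t then X else Y).
Proof.
apply/seteqP; split=> [x [Xx|Yx]|x [[] _ ?]]; [by exists true|by exists false| |].
- by left.
- by right.
Qed.

Lemma small_setU (U : Type) (X Y : set U) : small X -> small Y -> small (X `|` Y).
Proof.
move=> sX sY; rewrite setU_bigcup_bool; apply: small_bigcup => [|[]//].
exact/small_finite/finite_finset.
Qed.

Lemma nonsmall_avoid (U : Type) (X Y : set U) :
  ~ small X -> small Y -> exists2 a, X a & ~ Y a.
Proof.
move=> nX sY; apply: contrapT => /forall2NP H; apply: nX.
apply: small_subset sY => a Xa; apply: contrapT => nYa.
by case: (H a).
Qed.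

Lemma nonsmall_nonempty (U : Type) (X : set U) : ~ small X -> X !=set0.
Proof.
move=> nX; apply/set0P/eqP => X0; apply: nX; rewrite X0.
exact/small_finite/finite_set0.
Qed.

(** * At most [lam] points, and the regularity of [k] *)

(** The least [nu] such that [seg b] embeds in [seg nu] is a cardinal and at most [b], so below [k];
    hence it cannot exceed [lam]. *)
Lemma card_seg_succ b : b < k -> seg b #<= seg lam.
Proof.
move=> bk; have [|nu bnu nuP] := @wo_min _ _ [set c | seg b #<= seg c] T_wo.
  by exists b => /=; exact: card_lexx.
have nulam : nu <= lam.
  rewrite leNgt; apply/negP => lamnu; case: k_succ => _ _ /(_ nu) H.
  have /H : is_cardinal nu.
    move=> c cnu nuc; have /nuP : seg b #<= seg c by exact: card_le_trans nuc.
    by rewrite leNgt cnu.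
  move=> /(_ lamnu); apply/negP; rewrite -ltNge; apply: le_lt_trans bk.
  by apply: nuP; exact: card_lexx.
apply: card_le_trans bnu _; apply: subset_card_le => x /= xnu.
exact: lt_le_trans nulam.
Qed.

Lemma card_le_lamX (U V : Type) (X : set U) (Y : set V) :
  X #<= seg lam -> Y #<= seg lam -> X `*` Y #<= seg lam.
Proof.
move=> Xl Yl; apply: card_le_trans (card_le_setX Xl Yl) _.
by apply: card_seg_square => //; case: lam_reg.
Qed.

(** Choosing for each point an index [j x] and using an injection of that piece into [lam] embeds
    the union in the product of [D] and [seg lam]. *)
Lemma card_le_lam_bigcup (I U : Type) (D : set I) (F : I -> set U) :
  D #<= seg lam -> (forall i, D i -> F i #<= seg lam) ->
  \bigcup_(i in D) F i #<= seg lam.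
Proof.
move=> Dl Fl.
have [->|/set0P[u0 [i0 _ _]]] := eqVneq (\bigcup_(i in D) F i) set0.
  exact: card_ge0.
have /choice[h hP] : forall i, exists h : U -> T, D i ->
    (forall x, F i x -> h x < lam) /\
    (forall x y, F i x -> F i y -> h x = h y -> x = y).
  move=> i; have [Di|nDi] := pselect (D i); last by exists (fun=> lam).
  by have /(card_le_injP _ _ lam)[h [hF hi]] := Fl i Di; exists h.
have /choice[j jP] : forall x, exists i,
    (\bigcup_(i in D) F i) x -> D i /\ F i x.
  move=> x; have [[i Di Fi]|nx] := pselect ((\bigcup_(i in D) F i) x).
    by exists i.
  by exists i0 => /nx.
apply: card_le_trans (card_le_lamX Dl (card_lexx (seg lam))).
apply/(card_le_injP _ _ (i0, lam)); exists (fun x => (j x, h (j x) x)); split.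
  by move=> x /jP[Dj Fj]; split=> //=; case: (hP _ Dj) => + _; apply.
move=> x y /jP[Dx Fx] /jP[Dy Fy] [jE].
by rewrite -jE in Fy *; case: (hP _ Dx) => _; apply.
Qed.

Lemma card_le_lam_finite (U : Type) (X : set U) : finite_set X -> X #<= seg lam.
Proof.
move=> /finite_set_countable /card_le_trans; apply.
by apply/infiniteP; case: lam_reg.
Qed.

Lemma card_le_lamU (U : Type) (X Y : set U) :
  X #<= seg lam -> Y #<= seg lam -> X `|` Y #<= seg lam.
Proof.
move=> Xl Yl; rewrite setU_bigcup_bool; apply: card_le_lam_bigcup => [|[]//].
exact/card_le_lam_finite/finite_finset.
Qed.

Lemma succ_card_gt : ~ (seg k #<= seg lam).
Proof. by case: k_succ => + lk _; exact. Qed.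

(** If [X] were cofinal, [seg k] would be covered by at most [lam] sets of size at most [lam]. *)
Lemma succ_bounded X :
  X `<=` seg k -> X #<= seg lam -> exists2 c, c < k & X `<=` seg c.
Proof.
move=> Xk Xl; apply: not_cofinal_bounded => // -[_ Xcof].
apply: succ_card_gt.
have sub : seg k `<=` \bigcup_(x in X) (seg x `|` [set x]).
  move=> b /Xcof[x Xx]; rewrite le_eqVlt => /orP[/eqP->|bx]; exists x => //.
    by right.
  by left.
apply: card_le_trans (subset_card_le sub) _; apply: card_le_lam_bigcup => // x Xx.
apply: card_le_lamU; first exact/card_seg_succ/Xk.
exact/card_le_lam_finite/finite_set1.
Qed.

Lemma succ_image_bounded (I : Type) (D : set I) (f : I -> T) :
  D #<= seg lam -> (forall i, D i -> f i < k) ->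
  exists2 c, c < k & forall i, D i -> f i < c.
Proof.
move=> Dl fk; have [||c ck cP] := @succ_bounded (f @` D).
- by move=> _ [i Di <-]; exact: fk.
- by apply: card_le_trans Dl; exact: card_image_le.
by exists c => // i Di; apply: cP; exists i.
Qed.

Lemma succ_gt b : b < k -> exists2 c, b < c & c < k.
Proof.
move=> bk; have [||c ck /(_ tt I)] := @succ_image_bounded _ [set: unit] (fun=> b).
- exact/card_le_lam_finite/finite_finset.
- by [].
by exists c.
Qed.

Lemma card_succ_cofinal B : B `<=` seg k -> seg k #<= B -> cofinal_in B k.
Proof.
move=> Bk kB; apply: contrapT => /(not_cofinal_bounded Bk)[c ck Bc].
case: k_succ => /(_ c ck) + _ _; apply; apply: card_le_trans kB _.
exact: subset_card_le.
Qed.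

(** * Thin transversals and thinning of the stick sequence *)

(* Along an injection of J into lam, each point is chosen outside the earlier
   points and the C i whose index in lam has been reached: fewer than lam sets. *)
Lemma thin_transversal (J I : Type) (DJ : set J) (DI : set I)
    (Y : J -> set T) (C : I -> set T) :
  DJ #<= seg lam -> DI #<= seg lam ->
  (forall j I' P, DJ j -> I' `<=` DI -> small I' -> small P ->
    exists a, [/\ Y j a, ~ P a & forall i, I' i -> ~ C i a]) ->
  exists f : J -> T,
    [/\ forall j, DJ j -> Y j (f j),
        forall j j', DJ j -> DJ j' -> f j = f j' -> j = j'
      & forall i, DI i -> small (f @` DJ `&` C i)].
Proof.
move=> /(card_le_injP _ _ lam)[h [hl hi]] /(card_le_injP _ _ lam)[e [el ei]] YP.
have wf : well_founded (fun j j' : J => h j < h j').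
  exact: wf_inverse_image (wo_wf T_wo).
pose Q j (g : J -> T) v := [/\ Y j v,
  forall j', DJ j' -> h j' < h j -> g j' <> v &
  forall i, DI i -> e i <= h j -> ~ C i v].
have [|f fP] := @wf_dependent_choice J T _ lam Q wf.
  move=> j g g' v gg' [Yv gv Cv]; split=> // j' Dj' hj'.
  by rewrite -gg'//; exact: gv.
have fQ j : DJ j -> Q j f (f j).
  move=> Dj; apply: fP.
  have [||||v [Yv nPv Cv]] := YP j [set i | DI i /\ e i <= h j]
    (f @` [set j' | DJ j' /\ h j' < h j]) => //.
  - by move=> i [].
  - apply: small_card_le (small_seg_le (hl j Dj)); apply/(card_le_injP _ _ lam).
    by exists e; split=> [i []//|i i' [Di _] [Di' _]]; exact: ei.
  - apply/small_image/(small_card_le _ (small_seg (hl j Dj))).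
    apply/(card_le_injP _ _ lam).
    by exists h; split=> [i []//|i i' [Di _] [Di' _]]; exact: hi.
  exists v; split=> // [j' Dj' hj' fj'|i Di eij].
    by apply: nPv; exists j'.
  exact: Cv.
exists f; split=> [j /fQ[]//|j j' Dj Dj' fjj'|i Di].
  have [hjj'|hjj'|] := ltgtP (h j) (h j'); last exact: hi.
    by case: (fQ j' Dj') => _ /(_ j Dj hjj').
  by case: (fQ j Dj) => _ /(_ j' Dj' hjj'); rewrite fjj'.
(* From stage [e i] on every choice avoids [C i], so only points chosen earlier can lie in it. *)
apply: (@small_subset _ _ (f @` [set j | DJ j /\ h j < e i])).
  move=> _ [[j Dj <-] Cj]; exists j => //; split=> //.
  by rewrite ltNge; apply/negP => eh; case: (fQ j Dj) => _ _ /(_ i Di eh).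
apply/small_image/(small_card_le _ (small_seg (el i Di))).
apply/(card_le_injP _ _ lam).
by exists h; split=> [j []//|j j' [Dj _] [Dj' _]]; exact: hi.
Qed.

(* The sets x b have order type lam, and s b = sup (x b). *)
Definition thin_stick (x : T -> set T) (s : T -> T) :=
  [/\ forall b, b < k -> [/\ x b `<=` seg k, x b #<= seg lam & ~ small (x b)],
      forall b, b < k -> s b < k /\ x b `<=` seg (s b),
      forall b c, b < k -> c < s b -> small (x b `&` seg c)
    & forall X, cofinal_in X k -> exists2 b, b < k & x b `<=` X].

(** Each [x b] is cut off at the least [s b] below which it has [lam] points. Its parts below any
    smaller bound are then small, and shrinking the sets preserves the guessing. *)
Lemma stick_thin : stick lam k -> exists x s, thin_stick x s.
Proof.
move=> [x [xs xP]].
have xk b : b < k -> [/\ x b `<=` seg k, x b #<= seg lam & ~ small (x b)].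
  move=> /xs [xbk]; rewrite card_eq_le => /andP[xl lx].
  by split=> //; exact.
have /choice[s sP] : forall b, exists s, b < k ->
    [/\ s < k, ~ small (x b `&` seg s) & forall c, c < s -> small (x b `&` seg c)].
  move=> b; have [bk|nbk] := pselect (b < k); last by exists b.
  have [xbk xl nx] := xk b bk; have [c ck xc] := succ_bounded xbk xl.
  have nsc : ~ small (x b `&` seg c) by rewrite (setIidl xc).
  have [|m nm mP] := @wo_min _ _ [set m | ~ small (x b `&` seg m)] T_wo.
    by exists c.
  exists m => _; split=> // [|m' m'm].
    by apply: le_lt_trans ck; exact: mP.
  by apply: contrapT => /mP; rewrite leNgt m'm.
exists (fun b => x b `&` seg (s b)), s; split.
- move=> b bk; have [xbk xl nx] := xk b bk; have [sk ns _] := sP b bk; split=> //.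
    by move=> y [/xbk].
  by apply: card_le_trans xl; exact: subset_card_le.
- by move=> b bk; have [sk _ _] := sP b bk; split=> // y [].
- move=> b c bk cs; have [_ _ /(_ c cs)] := sP b bk; apply: small_subset.
  by move=> y [[]].
- move=> X /xP[b bk xb]; exists b => // y [yx _]; exact: xb.
Qed.

End SuccessorOfRegular.

(** * Guesses of rank two *)

Section Guessing.
Local Open Scope order_scope.
Local Open Scope classical_set_scope.
Local Open Scope card_scope.
Import Order.TTheory.
Context {d : Order.disp_t} {T : orderType d}.
Context (T_wo : @well_order T (fun x y : T => x <= y)) (lam k : T).
Context (lam_reg : infinite_regular_cardinal lam) (k_succ : succ_cardinal lam k).
Context (x : T -> set T) (s : T -> T) (x_thin : thin_stick lam k x s).
Implicit Types (a b c e : T) (A B C X : set T).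
Local Notation small := (small lam).

(** Indices are separated as well as suprema, because [A t] is known to have small intersection with
    [x b] only when both [b] and [s b] are below [t]. *)
Definition spread e := forall b b', x e b -> x e b' -> b <> b' ->
  (forall y, x b y -> b' <= y /\ s b' <= y) \/
  (forall y, x b' y -> b <= y /\ s b <= y).

Definition blocks e := \bigcup_(b in x e) x b.

Lemma blocks_bounded e : e < k -> exists2 c, c < k & blocks e `<=` seg c.
Proof.
case: x_thin => x1 x2 _ _ ek; have [xk xl _] := x1 e ek.
have [|c ck cP] := @succ_image_bounded _ _ T_wo _ _ lam_reg k_succ _ _ s xl.
  by move=> b /xk/x2[].
exists c => // y [b xb /(x2 b (xk b xb)).2 /= ys].
by apply: lt_trans ys _; exact: cP.
Qed.

(* Choose k many x b inside B, each one above all indices and suprema of the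
   previous ones, and apply the stick principle to the set of their indices. *)
Lemma spread_blocks_inside B c : cofinal_in B k -> c < k ->
  exists e, [/\ e < k, spread e, blocks e `<=` B & forall y, blocks e y -> c <= y].
Proof.
case: x_thin => x1 x2 x3 x4 [Bk Bcof] ck.
pose Q a (g : T -> T) v := [/\ v < k, x v `<=` B &
  forall y, x v y -> c <= y /\ forall a', a' < a -> g a' <= y /\ s (g a') <= y].
have [|f fP] := @wf_dependent_choice T T _ lam Q (wo_wf T_wo).
  move=> a g g' v gg' [vk vB vy]; split=> // y /vy[cy ay]; split=> // a' a'a.
  by rewrite -gg'//; exact: ay.
have fQ a : a < k -> Q a f (f a).
  elim: a / (wo_wf T_wo a) => a _ IH ak; apply: fP.
  have fk a' : seg a a' -> f a' < k.
    by move=> /= a'a; have [] := IH a' a'a (lt_trans a'a ak).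
  have al := card_seg_succ T_wo k_succ ak.
  have [c1 c1k c1P] := succ_image_bounded T_wo lam_reg k_succ al fk.
  have [|c2 c2k c2P] := @succ_image_bounded _ _ T_wo _ _ lam_reg k_succ _ _ (s \o f) al.
    by move=> a' /fk/x2[].
  pose c3 := Order.max c (Order.max c1 c2).
  have [|v vk vB] := x4 (B `&` [set y | c3 <= y]).
    split=> [y [/Bk]//|b bk].
    have [|y By] := Bcof (Order.max b c3); first by rewrite !gt_max bk ck c1k.
    by rewrite ge_max => /andP[b_y cy]; exists y.
  exists v; split=> // [y /vB[]//|y /vB[_ /=]]; rewrite !ge_max.
  move=> /and3P[cy c1y c2y]; split=> // a' a'a; split; apply: ltW.
    by apply: lt_le_trans c1y; exact: c1P.
  by apply: lt_le_trans c2y; exact: c2P.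
have xne b : b < k -> exists y, x b y.
  by move=> /x1[_ _ /(nonsmall_nonempty lam_reg)].
have sep a a' y : a' < a -> a < k -> x (f a) y -> f a' <= y /\ s (f a') <= y.
  by move=> a'a ak xy; have [_ _ /(_ y xy)[_]] := fQ a ak; exact.
(* If [f b = f b'] with [b' < b], the nonempty set [x (f b)] would lie both below [s (f b)] and at
   or above it. Injectivity gives the set of indices size [k], hence makes it cofinal. *)
have finj a a' : a < k -> a' < k -> f a = f a' -> a = a'.
  suff H b b' : b' < b -> b < k -> f b <> f b'.
    move=> ak a'k faa'; case: (ltgtP a a') => // [aa'|a'a].
      by have := H _ _ aa' a'k; rewrite faa'.
    by have := H _ _ a'a ak; rewrite faa'.
  move=> b'b bk fbb'; have [fk _ _] := fQ b bk; have [y xy] := xne _ fk.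
  have [_] := sep _ _ _ b'b bk xy; rewrite -fbb' leNgt.
  by have -> : y < s (f b) by exact: (x2 _ fk).2.
have [|e ek xe] := x4 (f @` seg k).
  apply: (card_succ_cofinal k_succ).
    by move=> _ [a ak <-]; have [] := fQ a ak.
  by apply/(card_le_injP _ _ lam); exists f; split=> // a ak; exists a.
exists e; split=> // [b b' xb xb' bb'|y [b /xe[a ak <-] xy]|y [b /xe[a ak <-] xy]].
- move: bb'; have [a ak <-] := xe b xb; have [a' a'k <-] := xe b' xb'.
  have [aa' _|a'a _|->//] := ltgtP a a'; [right|left] => y; exact: sep.
- by have [_ + _] := fQ a ak; exact.
- by have [_ _ /(_ y xy)[]] := fQ a ak.
Qed.

(** The set with the smaller supremum meets the other only inside a proper initial part, which is
    small. *)
Lemma sup_of_nonsmall_meet b b' :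
  b < k -> b' < k -> ~ small (x b `&` x b') -> s b = s b'.
Proof.
case: x_thin => x1 x2 x3 x4 bk b'k nI.
have [sbb'|sb'b|//] := ltgtP (s b) (s b'); case: nI.
  apply: small_subset (x3 b' (s b) b'k sbb') => y [xy x'y]; split=> //.
  exact: (x2 b bk).2.
apply: small_subset (x3 b (s b') bk sb'b) => y [xy x'y]; split=> //.
exact: (x2 b' b'k).2.
Qed.

(* Each A t and each x w meets at most one of the pieces x b, b in x e, in lam
   many points. *)
Lemma spread_blocks_not_covered e (A : T -> set T) (D W P : set T) :
  e < k -> spread e -> small D -> small W -> small P -> W `<=` seg k ->
  (forall t, D t -> A t `<=` seg t /\
    forall b, b < t -> b < k -> s b < t -> small (A t `&` x b)) ->
  exists a, [/\ blocks e a, ~ P a, forall t, D t -> ~ A t a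
              & forall w, W w -> ~ x w a].
Proof.
case: x_thin => x1 x2 x3 x4 ek spe sD sW sP Wk AP.
have [xk _ nxe] := x1 e ek.
have xne b : b < k -> exists y, x b y.
  by move=> /x1[_ _ /(nonsmall_nonempty lam_reg)].
(* When each point of [E] is related to at most one block, the exceptional blocks are values of a
   function, so a small [E] produces a small set of them. *)
have one (R : T -> T -> Prop) (E : set T) :
    (forall t b b', E t -> R t b -> R t b' -> b = b') ->
    exists u : T -> T, forall t b, E t -> R t b -> b = u t.
  move=> R1; suff /choice[u uP] : forall t, exists u, E t -> forall b, R t b -> b = u.
    by exists u => t b Et Rtb; exact: uP.
  move=> t; have [[u Ru]|nR] := pselect (exists u, R t u).
    by exists u => Et b Rb; exact: R1 Rb Ru.
  by exists t => _ b Rb; case: nR; exists b.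
have [|u uP] := one (fun t b => x e b /\ ~ small (A t `&` x b)) D.
  (* Suppose [x b] lies above the index and the supremum of [b']. A point of [A t] in [x b] then
     puts both [b'] and [s b'] below [t], so the intersection of [A t] with [x b'] is small. *)
  have H t b b' : D t -> x e b -> x e b' -> ~ small (A t `&` x b) ->
      ~ small (A t `&` x b') -> (forall y, x b y -> b' <= y /\ s b' <= y) -> False.
    move=> Dt xb xb' nb nb' hb; have [At Asm] := AP t Dt.
    have [y [Ay xy]] := nonsmall_nonempty lam_reg nb.
    have [b'y sb'y] := hb y xy; apply: nb'; apply: Asm.
    - exact: le_lt_trans b'y (At y Ay).
    - exact: xk.
    - exact: le_lt_trans sb'y (At y Ay).
  move=> t b b' Dt [xb nb] [xb' nb']; apply: contrapT => bb'.
  by case: (spe b b' xb xb' bb') => ?; [apply: (H t b b')|apply: (H t b' b)].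
have [|v vP] := one (fun w b => x e b /\ ~ small (x w `&` x b)) W.
  move=> w b b' Ww [xb nb] [xb' nb']; apply: contrapT => bb'.
  (* Both suprema equal [s w], yet one of the two blocks lies at or above the supremum of the
     other. *)
  have sE : s b = s b'.
    rewrite -(sup_of_nonsmall_meet (Wk w Ww) (xk b xb) nb).
    exact: sup_of_nonsmall_meet (Wk w Ww) (xk b' xb') nb'.
  case: (spe b b' xb xb' bb') => H.
    have [y xy] := xne b (xk b xb); have := (x2 b (xk b xb)).2 y xy => /=.
    by rewrite /seg /= sE ltNge (H y xy).2.
  have [y xy] := xne b' (xk b' xb'); have := (x2 b' (xk b' xb')).2 y xy => /=.
  by rewrite /seg /= -sE ltNge (H y xy).2.
(* Outside these exceptional indices, every [A t] and [x w] has small trace on [x b], and a small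
   union of small traces cannot cover it. *)
have [|b xb nb] := nonsmall_avoid nxe (Y := u @` D `|` v @` W).
  by apply: small_setU => //; exact: small_image.
have [_ _ nxb] := x1 b (xk b xb).
have [|a xa na] := nonsmall_avoid nxb (Y := P `|`
    (\bigcup_(t in D) (A t `&` x b) `|` \bigcup_(w in W) (x w `&` x b))).
  apply: small_setU => //; apply: small_setU => //; apply: small_bigcup => // t Dt.
    apply: contrapT => nt; apply: nb; left; exists t => //.
    by rewrite -(uP t b).
  apply: contrapT => nt; apply: nb; right; exists t => //.
  by rewrite -(vP t b).
exists a; split=> [|Pa|t Dt Aa|w Ww xwa].
- by exists b.
- by apply: na; left.
- by apply: na; right; left; exists t.
- by apply: na; right; right; exists w.
Qed.

(** * The recursive construction *)

(* F enumerates the family at a; p and q range over the prescriptions "meet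
   blocks p above q", which bind only when blocks p lies in [q, a). *)
Definition stage_spec a (A : T -> set T) (F : T -> set T) :=
  [/\ forall i, i < lam -> F i `<=` seg a,
      forall i j, i < lam -> j < lam -> F i `&` F j !=set0 -> i = j,
      forall i p q, i < lam -> p < a -> q < a ->
        exists2 y, F i y & q <= y /\
          (spread p -> blocks p `<=` [set y | q <= y < a] -> blocks p y),
      forall t, t < a -> E_cof k lam t ->
        small (\bigcup_(i in seg lam) F i `&` A t)
    & forall b, b < a -> s b < a -> small (\bigcup_(i in seg lam) F i `&` x b)].

(** A thin transversal over the triples [(i, p, q)] picks distinct points, each obeying its
    prescription; [F i] collects those with first entry [i], whence disjointness. *)
Lemma stage a (A : T -> set T) : a < k -> cf_is a lam ->
  (forall t, t < a -> E_cof k lam t -> A t `<=` seg t /\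
    forall b, b < t -> s b < t -> small (A t `&` x b)) ->
  exists F, stage_spec a A F.
Proof.
case: x_thin => x1 x2 x3 x4 ak cfa AP.
have al := card_seg_succ T_wo k_succ ak.
pose Y (j : T * T * T) : set T := [set y | j.2 <= y < a /\
  (spread j.1.2 -> blocks j.1.2 `<=` [set y | j.2 <= y < a] -> blocks j.1.2 y)].
(* The tag is true for the sets [A t] and false for the guesses [x b]. *)
pose DI : set (bool * T) :=
  [set i | i.2 < a /\ if i.1 then E_cof k lam i.2 else s i.2 < a].
pose C (i : bool * T) := if i.1 then A i.2 else x i.2.
have [|||f [fY finj fC]] := @thin_transversal _ _ T_wo _ lam_reg _ _
    (seg lam `*` seg a `*` seg a) DI Y C.
- apply: (card_le_lamX T_wo lam_reg) => //.
  by apply: (card_le_lamX T_wo lam_reg) => //; exact: card_lexx.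
- have : DI `<=` [set: bool] `*` seg a by move=> i [].
  move=> /subset_card_le/card_le_trans; apply.
  apply: (card_le_lamX T_wo lam_reg) => //.
  exact/card_le_lam_finite/finite_finset.
- move=> [[i p] q] I' P [[/= il pa] qa] I'D sI' sP.
  pose D := [set t | I' (true, t)]; pose W := [set b | I' (false, b)].
  have sD : small D.
    apply: (@small_subset _ _ _ _ _ (snd @` I')); last exact: small_image.
    by move=> t It; exists (true, t).
  have sW : small W.
    apply: (@small_subset _ _ _ _ _ (snd @` I')); last exact: small_image.
    by move=> t It; exists (false, t).
  have [[spp subp]|nsp] := pselect
      (spread p /\ blocks p `<=` [set y | q <= y < a]).
    have [||y [py nPy Dy Wy]] := @spread_blocks_not_covered p A D W P
      (lt_trans pa ak) spp sD sW sP.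
    + by move=> b /I'D[/= ba _]; exact: lt_trans ak.
    + move=> t /I'D[/= ta Et]; have [At Asm] := AP t ta Et; split=> // b bt _.
      exact: Asm.
    exists y; split=> // [|[[] t] It]; first by split=> //; exact: subp.
      exact: Dy.
    exact: Wy.
  (* The prescription does not bind, so any point of [[q, a)] clear of the forbidden sets will do.
     As [a] has cofinality [lam], the indices in [D], the suprema over [W] and the part of [P] below
     [a] are all bounded below [a], and the point is taken past these bounds. *)
  have [||c1 c1a c1P] := @small_bounded _ _ lam a D cfa => //.
    by move=> t /I'D[].
  have [||c2 c2a c2P] := @small_bounded _ _ lam a (s @` W) cfa => //.
  + by move=> _ [b /I'D[/= _ sb] <-].
  + exact: small_image.
  have [||c3 c3a c3P] := @small_bounded _ _ lam a (P `&` seg a) cfa => //.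
    by apply: small_subset sP => y [].
  pose y := Order.max q (Order.max c1 (Order.max c2 c3)).
  have ya : y < a by rewrite !gt_max qa c1a c2a.
  have qy : q <= y by rewrite le_max lexx.
  have c1y : c1 <= y by rewrite !le_max lexx orbT.
  have c2y : c2 <= y by rewrite !le_max lexx !orbT.
  have c3y : c3 <= y by rewrite !le_max lexx !orbT.
  exists y; split=> [|Py|[[] t] It /= ty].
  + by split=> [|? ?]; [rewrite /= qy|case: nsp].
  + by have /= := c3P y (conj Py ya); rewrite /seg /= ltNge c3y.
  + have [/= ta Et] := I'D _ It; have [At _] := AP t ta Et.
    have := lt_trans (At y ty) (c1P t It); apply/negP.
    by rewrite -leNgt.
  + have [/= ta sta] := I'D _ It.
    have ys := (x2 t (lt_trans ta ak)).2 y ty.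
    have := lt_trans ys (c2P (s t) (imageP s It)); apply/negP.
    by rewrite -leNgt.
pose F i := [set y | exists p q, [/\ p < a, q < a & y = f (i, p, q)]].
have UF : \bigcup_(i in seg lam) F i `<=` f @` (seg lam `*` seg a `*` seg a).
  by move=> y [i il [p [q [pa qa ->]]]]; exists (i, p, q).
exists F; split.
- move=> i il y [p [q [pa qa ->]]].
  by have [|/andP[]] := fY (i, p, q) => //.
- move=> i j il jl [y [[p [q [pa qa ->]]] [p' [q' [p'a q'a]]]]].
  by move=> /finj-/(_ (conj (conj il pa) qa) (conj (conj jl p'a) q'a))[].
- move=> i p q il pa qa; exists (f (i, p, q)); first by exists p, q.
  by have [|/andP[qf _] H] := fY (i, p, q).
- move=> t ta Et; apply: small_subset (fC (true, t) _) => //.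
  by move=> y [/UF].
- move=> b ba sba; apply: small_subset (fC (false, b) _) => //.
  by move=> y [/UF].
Qed.

Lemma stages : exists F : T -> T -> set T, forall a, E_cof k lam a ->
  stage_spec a (fun t => \bigcup_(i in seg lam) F t i) (F a).
Proof.
have [|F FP] := @wf_dependent_choice T (T -> set T) _ (fun=> set0)
    (fun a g v => stage_spec a (fun t => \bigcup_(i in seg lam) g t i) v)
    (wo_wf T_wo).
  move=> a g g' v gg' [v1 v2 v3 v4 v5]; split=> // t ta Et.
  by rewrite -gg'//; exact: v4.
exists F => a; elim: a / (wo_wf T_wo a) => a _ IH [ak cfa]; apply: FP.
(* The first and last clauses of [stage_spec] at earlier points are what [stage] asks of the sets
   already built. *)
apply: stage => // t ta Et; have [F1 _ _ _ F5] := IH t ta Et; split.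
  by move=> y [i il /F1]; exact.
exact: F5.
Qed.

(** * Closure points, and verification of the three clauses *)

(** Unboundedness comes from iterating a choice of witnesses countably often and taking the
    supremum. Monotonicity in the first argument passes from the iterates to all points below the
    supremum. *)
Lemma closure_points_club (H : T -> T -> Prop) :
  (forall b c, H b c -> b < c) ->
  (forall b b' c, b' <= b -> H b c -> H b' c) ->
  (forall b, b < k -> exists2 c, c < k & H b c) ->
  is_club k [set a | [/\ a < k, exists b, b < a
    & forall b, b < a -> exists2 c, c < a & H b c]].
Proof.
move=> Hlt Hanti Hex; split; first split=> [a []//|b bk].
  have /choice[h hP] : forall b, exists c, b < k -> c < k /\ H b c.
    move=> b'; have [b'k|] := pselect (b' < k); last by exists b'.
    by have [c ck Hc] := Hex b' b'k; exists c.
  pose u n := iter n h b.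
  have uk n : u n < k by elim: n => //= n /hP[].
  have [||c ck cP] := @succ_image_bounded _ _ T_wo _ _ lam_reg k_succ _ [set: nat] u.
  - by apply/infiniteP; case: lam_reg.
  - by [].
  have [|m mP mmin] := @wo_min _ _ [set m | forall n, u n < m] T_wo.
    by exists c => n; exact: cP.
  exists m; last exact/ltW/(mP 0).
  split; first by apply: le_lt_trans ck; apply: mmin => n; exact: cP.
    by exists b; exact: (mP 0).
  move=> b' b'm.
  have [n b'n] : exists n, b' <= u n.
    apply: contrapT => /forallNP nu; have /mmin : forall n, u n < b'.
      by move=> n; rewrite ltNge; apply/negP/nu.
    by rewrite leNgt b'm.
  exists (u n.+1) => //; apply: Hanti b'n _.
  by have [] := hP (u n) (uk n).
move=> a ak [[b0 b0a] alim] [_ acof]; split=> //; first by exists b0.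
move=> b ba; have [b' bb' b'a] := alim b ba.
have [c [[ck _ cP] /= ca] b'c] := acof b' b'a.
have [e ec He] := cP b (lt_le_trans bb' b'c).
by exists e => //; exact: lt_trans ca.
Qed.

Lemma cofinal_sup A a : is_limit a -> cofinal_in A a -> sup_is A a.
Proof.
move=> [_ alim] [Aa Acof]; split=> [y /Aa/ltW//|u uP].
rewrite leNgt; apply/negP => ua; have [c uc ca] := alim u ua.
have [y Ay cy] := Acof c ca; have := le_lt_trans (uP y Ay) uc.
by rewrite ltNge cy.
Qed.

Lemma bounded_sup_lt A B a c : is_limit a -> cofinal_in A a ->
  c < a -> B `<=` seg c -> sup_lt B A.
Proof.
move=> alim Aa ca Bc; have [|m mB mmin] := @wo_min _ _ (ubound B) T_wo.
  by exists c => y /Bc /ltW.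
exists m, a; split=> //; first exact: cofinal_sup.
by apply: le_lt_trans ca; apply: mmin => y /Bc /ltW.
Qed.

Lemma stage_cofinal a (A F : T -> set T) i :
  cf_is a lam -> stage_spec a A F -> i < lam -> cofinal_in (F i) a.
Proof.
move=> cfa [F1 _ F3 _ _] il; split=> [|b ba]; first exact: F1.
by have [y Fy [by_ _]] := F3 i b b il ba ba; exists y.
Qed.

Lemma stages_club_ad (SS : set (set T)) :
  partition SS (fun S : set T => S) (E_cof k lam) ->
  (forall S : set T, SS S -> stationary k S) -> club_ad k SS lam lam.
Proof.
move=> [covSS _ _] statSS; have [F FP] := stages.
have SSE S a : SS S -> S a -> E_cof k lam a.
  by move=> SSS Sa; rewrite -covSS; exists S.
exists (fun a => F a @` seg lam); split.
- move=> a [S SSS Sa] _; have Ea := SSE S a SSS Sa; have [_ cfa] := Ea.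
  have Fa := FP a Ea; have [_ F2 _ _ _] := Fa.
  have cofF i : i < lam -> cofinal_in (F a i) a by move=> il; exact: stage_cofinal Fa il.
  split.
  + by move=> _ _ [i il <-] [j jl <-] /(F2 i j il jl) ->.
  (* The sets [F a i] are nonempty and disjoint, so equal ones have equal indices and the family has
     exactly [lam] members. *)
  + apply: inj_card_eq => i j /set_mem il /set_mem jl Fij; apply: F2 => //.
    rewrite -Fij setIid; have [b ba] := cf_nonempty lam_reg cfa.
    by have [y Fy _] := (cofF i il).2 b ba; exists y.
  + by move=> _ [i il <-]; exact: cofF.
- move=> BB BBk; rewrite card_eq_le => /andP[BBl _] S SSS.
  have [Sk Sstat] := statSS S SSS; split=> [a [/Sk]//|C Cclub].
  have [[Ck Ccof] Ccl] := Cclub.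
  (* Closure points of [H] are limits of points of [C], hence in [C], and below them every [B]
     contains spread blocks arbitrarily high, with index below the same point. *)
  pose H b c := [/\ b < c, exists2 y, C y & b <= y < c &
    forall B, BB B -> exists e, [/\ e < c, spread e, blocks e `<=` B
      & blocks e `<=` [set y | b <= y < c]]].
  have HC : is_club k [set a | [/\ a < k, exists b, b < a
      & forall b, b < a -> exists2 c, c < a & H b c]].
    apply: closure_points_club => [b c []//|b b' c b'b [bc [y Cy /andP[yb yc]] HB]|b bk].
      split; first exact: le_lt_trans bc.
        by exists y => //; rewrite yc (le_trans b'b yb).
      move=> B /HB[e [ec spe eB ebc]]; exists e; split=> // z /ebc /=.
      by move=> /andP[bz ->]; rewrite (le_trans b'b bz).
    have /choice[h hP] : forall B, exists c, BB B -> c < k /\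
        exists e, [/\ e < c, spread e, blocks e `<=` B
      & blocks e `<=` [set y | b <= y < c]].
      move=> B; have [BBB|] := pselect (BB B); last by exists b.
      have [Bk Bcard] := BBk B BBB; move: Bcard.
      rewrite card_eq_le => /andP[_ kB].
      have [e [ek spe eB be]] := spread_blocks_inside (card_succ_cofinal k_succ Bk kB) bk.
      have [c ck ec] := blocks_bounded ek.
      have [e' ee' e'k] := succ_gt T_wo lam_reg k_succ ek.
      exists (Order.max c e') => _; split; first by rewrite gt_max ck.
      exists e; split=> // [|y ey]; first by rewrite lt_max ee' orbT.
      by rewrite /= be //= lt_max ec.
    (* Since [BB] has at most [lam] members, one bound below [k] serves them all. *)
    have [|c1 c1k c1P] := @succ_image_bounded _ _ T_wo _ _ lam_reg k_succ _ _ h BBl.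
      by move=> B /hP[].
    have [y Cy b_y] := Ccof b bk.
    have [c2 yc2 c2k] := succ_gt T_wo lam_reg k_succ (Ck y Cy).
    exists (Order.max c1 c2); first by rewrite gt_max c1k.
    split; first by rewrite lt_max (le_lt_trans b_y yc2) orbT.
      by exists y => //; rewrite b_y lt_max yc2 orbT.
    move=> B BBB; have [_ [e [eh spe eB eb]]] := hP B BBB.
    exists e; split=> // [|z /eb /= /andP[-> zh]].
      by rewrite lt_max (lt_trans eh (c1P B BBB)).
    by rewrite lt_max (lt_trans zh (c1P B BBB)).
  have [a [Sa [ak a0 aH]]] := Sstat _ HC.
  have Ea := SSE S a SSS Sa; have [_ cfa] := Ea.
  have Fa := FP a Ea; have [F1 _ F3 _ _] := Fa.
  exists a; split; last first.
    apply: Ccl => //; first exact: (cf_limit lam_reg).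
    split=> [y []//|b ba]; have [c ca [_ [y Cy /andP[b_y yc]] _]] := aH b ba.
    by exists y => //; split=> //; exact: lt_trans ca.
  split=> // _ B [i il <-] BBB; apply: cofinal_sup; first exact: (cf_limit lam_reg).
  split=> [y [/(F1 i il)]//|b ba].
  have [c ca [_ _ /(_ B BBB)[e [ec spe eB ebc]]]] := aH b ba.
  (* The prescription for [e] and [b] binds, because the blocks of [e] lie in [[b, a)]; it yields a
     point of [F a i] in [B] at or above [b]. *)
  have [y Fy [b_y ey]] := F3 i e b il (lt_trans ec ca) ba.
  exists y => //; split=> //; apply/eB/ey => // z /ebc /= /andP[-> zc].
  exact: lt_trans ca.
- move=> _ _ [S SSS [a Sa [i il <-]]] [S' SSS' [a' Sa' [i' i'l <-]]] neq.
  have Ea := SSE S a SSS Sa; have [_ cfa] := Ea.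
  have Ea' := SSE S' a' SSS' Sa'; have [_ cfa'] := Ea'.
  have Fa := FP a Ea; have Fa' := FP a' Ea'.
  have lima := cf_limit lam_reg cfa; have cofa := stage_cofinal cfa Fa il.
  suff [c ca Fc] : exists2 c, c < a & F a i `&` F a' i' `<=` seg c.
    exact: (bounded_sup_lt lima cofa ca Fc).
  (* For [a < a'] the later family has small intersection with the earlier one, so the intersection
     is bounded below [a] by cofinality. For [a' < a] the set [F a' i'] is already bounded by [a'].
     For equal points the two sets are disjoint. *)
  have [aa'|a'a|aa'] := ltgtP a a'.
  + apply: (small_bounded cfa) => [y [/(cofa.1)]//|].
    have [_ _ _ /(_ a aa' Ea) F4 _] := Fa'.
    by apply: small_subset F4 => y [Fy F'y]; split; [exists i'|exists i].
  + by exists a' => // y [_]; case: Fa' => /(_ i' i'l) + _ _ _ _; apply.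
  + have [c ca] := cf_nonempty lam_reg cfa; exists c => // y Fy; exfalso.
    subst a'; have [_ /(_ i i' il i'l) F2 _ _ _] := Fa; apply: neq.
    by rewrite F2 //; exists y.
Qed.

End Guessing.

Theorem theoremB (d : Order.disp_t) (T : orderType d)
    (T_wo : @well_order T (fun x y : T => (x <= y)%O))
    (lam k : T)
    (lam_reg : infinite_regular_cardinal lam)
    (k_succ : succ_cardinal lam k)
    (k_stick : stick lam k)
    (SS : set (set T))
    (SS_part : partition SS (fun S : set T => S) (E_cof k lam))
    (SS_stat : forall S : set T, SS S -> stationary k S) :
  club_ad k SS lam lam.
Proof.
have [x [s x_thin]] := stick_thin T_wo lam_reg k_succ k_stick.
exact: (stages_club_ad T_wo lam_reg k_succ x_thin SS_part SS_stat).
Qed.
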